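(* Let $\Gamma$ be a connected $\mathbb{Z}^n$-periodic metric graph with period cell $Y=\bigcup_{j=0}^mY_j$ decomposed as described in the context, and let $l_j$, $N_j$, and (for coupling constants $q_j>0$) $a_j,b_j$ be as defined in the context. Let $L>0$ be an arbitrarily large number and let $(\alpha_j,\beta_j)$, $j=1,\dots,m$, $m\in\mathbb{N}$, be arbitrary intervals satisfying $$0<\alpha_1,\qquad \alpha_j<\beta_j<\alpha_{j+1}\ (j=1,\dots,m-1),\qquad \alpha_m<\beta_m<L.$$ Suppose that the numbers $l_j$, $j=0,\dots,m$, satisfy $$l_j=l_0\,\frac{\beta_j-\alpha_j}{\alpha_j}\prod_{\substack{1\le i\le m\\ i\neq j}}\frac{\beta_i-\alpha_j}{\alpha_i-\alpha_j},\qquad j=1,\dots,m.$$ Then $$a_j=\alpha_j,\qquad b_j=\beta_j,\qquad j=1,\dots,m,$$ provided $$q_j=\frac{\alpha_jl_j}{N_j},\qquad j=1,\dots,m.$$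
   Context: **Graph.** $\Gamma$ is a connected metric graph with finite vertex degrees and edge lengths in $(0,\infty)$, no loops, embedded in $\mathbb{R}^d$ ($d=3$ if $n=1,2$; $d=n$ if $n\ge3$), and $\mathbb{Z}^n$-periodic: there are linearly independent vectors $e_1,\dots,e_n$ with $\Gamma=\Gamma+e_k$, $k=1,\dots,n$, and there is a compact period cell. A period cell is a compact $Y\subset\Gamma$ with $\overset{\circ}{Y}\cap(\overset{\circ}{Y}+\sum_k i_ke_k)=\varnothing$ for all $i\in\mathbb{Z}^n\setminus\{0\}$ and $\Gamma=\bigcup_{i\in\mathbb{Z}^n}(Y+\sum_k i_ke_k)$. Interior ($\overset{\circ}{Z}$ or $\mathrm{int}\,Z$) and boundary $\partial Z$ of $Z\subset\Gamma$ are with respect to the metric of $\Gamma$, with the convention that vertices of $\Gamma$ of degree 1 lying in $Z$ are counted as boundary points. $Y$ is chosen so that $\partial Y$ contains no vertex of $\Gamma$ of degree greater than 1; $\partial_{\mathrm{ext}}Y$ denotes the set of degree-1 vertices of $Y$ lying in the interiors of edges of $\Gamma$. **Decomposition.** $Y=\bigcup_{j=0}^mY_j$, $m\in\mathbb{N}$, with $Y_j$ compact, satisfying: (i) $\overset{\circ}{Y_j}\neq\varnothing$; (ii) each $Y_j$ is connected; (iii) $\mathrm{int}(Y_j\cap Y_k)=\varnothing$ for $j\ne k$, i.e. $Y_j,Y_k$ may share only vertices, not edges; (iv) $\partial_{\mathrm{ext}}Y\subset\partial Y_0$; (v) the sets $\mathcal{V}_j:=\partial Y_0\cap\partial Y_j$,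 $j=1,\dots,m$, are nonempty; (vi) if $j,k\neq0$, $j\ne k$, then $\partial Y_j\cap\partial Y_k=\varnothing$ or $\partial Y_j\cap\partial Y_k\subset\partial Y_0$. All points of $\bigcup_{j=1}^m\mathcal{V}_j$ are regarded as vertices of $\Gamma$. **Numbers.** $l_j$ is the total length of all edges in $Y_j$ ($j=0,\dots,m$), $N_j$ is the number of points of $\mathcal{V}_j$ ($j=1,\dots,m$). Given $q_1,\dots,q_m>0$, $a_j:=N_jq_j/l_j$, $j=1,\dots,m$. When $a_1<a_2<\dots<a_m$, the equation $$1+\sum_{i=1}^m\frac{a_il_i}{l_0(a_i-\lambda)}=0$$ has exactly $m$ roots $\lambda\in\mathbb{C}$; they are real, and $b_1<\dots<b_m$ denote these roots in ascending order. *)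

(* Defs.v *)
From HB Require Import structures.
From mathcomp Require Import all_boot all_order all_algebra finmap.
From mathcomp Require Import all_classical all_reals all_analysis.
From mathcomp Require Import complex.

Set Implicit Arguments.
Unset Strict Implicit.
Unset Printing Implicit Defensive.

Import Order.TTheory GRing.Theory Num.Theory.
Import numFieldNormedType.Exports.

Local Open Scope classical_set_scope.
Local Open Scope ring_scope.

(* The edge [e] is the arc [par e] of R^d, parametrized by [0, len e].  The
   length [len e] is the one prescribed by the metric graph, not the Euclidean
   length of the arc; [par e] is irrelevant outside [0, len e]. *)
Record graph_data (R : realType) (d : nat) := GraphData {
  edge : choiceType;
  len : edge -> R;
  par : edge -> R -> 'rV[R]_d
}.

Section MetricGraph.
Variables (R : realType) (d : nat) (G : graph_data R d).
Implicit Types (Y : set 'rV[R]_d) (x y v : 'rV[R]_d) (e : edge G) (s t : R).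

Definition carrier : set 'rV[R]_d :=
  [set x | exists e t, 0 <= t <= len e /\ x = par e t].

Definition incident v : set (edge G) :=
  [set e | v = par e 0 \/ v = par e (len e)].

(* Isolated vertices are not represented: a connected graph having an edge
   has none. *)
Definition vertices : set 'rV[R]_d := [set v | incident v !=set0].

(* Since there are no loops, the degree is the number of incident edges; it is
   meaningful at vertices only (points inside edges get the value 0). *)
Definition degree v : nat := #|` fset_set (incident v)|.

(* [walk x y r]: there is a walk of length r from x to y in the graph. *)
Inductive walk : 'rV[R]_d -> 'rV[R]_d -> R -> Prop :=
| walk_nil x : carrier x -> walk x x 0
| walk_step e s t y r : 0 <= s <= len e -> 0 <= t <= len e ->
    walk (par e t) y r -> walk (par e s) y (`|s - t| + r).

Definition gdist x y : \bar R := ereal_inf [set r%:E | r in walk x y].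

Definition gball x (eps : R) : set 'rV[R]_d :=
  [set y | carrier y /\ (gdist x y < eps%:E)%E].

Record embedded_metric_graph : Prop := {
  len_gt0 : forall e, 0 < len e;
  par_continuous : forall e, {within `[0, len e], continuous (par e)};
  (* injectivity up to the endpoints: no loops *)
  par_inj : forall e s t, 0 <= s <= len e -> 0 <= t <= len e ->
    par e s = par e t -> s = t;
  (* distinct edges meet at most at their endpoints *)
  par_cross : forall e1 e2 s t, e1 <> e2 ->
    0 <= s <= len e1 -> 0 <= t <= len e2 -> par e1 s = par e2 t ->
    (s = 0 \/ s = len e1) /\ (t = 0 \/ t = len e2);
  degree_finite : forall v, finite_set (incident v);
  (* The graph metric induces on the graph the topology of R^d.  Hence
     connectedness and compactness of subsets of the graph can be taken in
     R^d. *)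
  gdist_topology : forall x, carrier x -> forall U : set 'rV[R]_d,
    within carrier (nbhs x) U <-> exists2 eps, 0 < eps & gball x eps `<=` U;
  carrier_connected : connected carrier
}.

(* Interior and boundary in the graph metric, except that vertices of degree 1
   belonging to Y count as boundary points. *)
Definition gint Y : set 'rV[R]_d :=
  [set x | [/\ carrier x, degree x <> 1%N &
    exists2 eps, 0 < eps & gball x eps `<=` Y]].

Definition gboundary Y : set 'rV[R]_d :=
  [set x | carrier x /\
    ((Y x /\ degree x = 1%N) \/
     (forall eps, 0 < eps ->
        gball x eps `&` Y !=set0 /\ gball x eps `\` Y !=set0))].

(* Points of degree 1 of Y inside an edge of the graph: near such a point, Y
   occupies exactly one side of the edge. *)
Definition ext_boundary Y : set 'rV[R]_d :=
  [set x | exists e t, [/\ 0 < t < len e, x = par e t &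
    exists2 eps, 0 < eps &
      (forall s, 0 <= s <= len e -> `|s - t| < eps ->
         Y (par e s) <-> s <= t) \/
      (forall s, 0 <= s <= len e -> `|s - t| < eps ->
         Y (par e s) <-> t <= s)]].

(* Y may contain proper parts of edges, hence the Lebesgue measure of the part
   of each edge that lies in Y. *)
Definition total_length Y : R :=
  fine (\esum_(e in [set: edge G])
    lebesgue_measure [set t : R | 0 <= t <= len e /\ Y (par e t)]).

End MetricGraph.

Section Periodic.
Variables (R : realType) (d n : nat) (G : graph_data R d).
Variable per : n.-tuple 'rV[R]_d.

Definition shift_set (v : 'rV[R]_d) (A : set 'rV[R]_d) : set 'rV[R]_d :=
  [set x + v | x in A].

Definition lattice_vec (i : 'rV[int]_n) : 'rV[R]_d :=
  \sum_(k < n) tnth per k *~ i ord0 k.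

Record periodic_graph : Prop := {
  periods_free : free per;
  periodic_carrier : forall k, shift_set (tnth per k) (carrier G) = carrier G;
  (* translations preserve the metric structure, in particular the lengths *)
  periodic_gdist : forall k x y, carrier G x -> carrier G y ->
    gdist G (x + tnth per k) (y + tnth per k) = gdist G x y
}.

Record period_cell (Y : set 'rV[R]_d) : Prop := {
  cell_sub : Y `<=` carrier G;
  cell_compact : compact Y;
  cell_disjoint : forall i, i != 0 ->
    gint G Y `&` shift_set (lattice_vec i) (gint G Y) = set0;
  cell_cover :
    carrier G = \bigcup_(i in [set: 'rV[int]_n]) shift_set (lattice_vec i) Y;
  cell_boundary : forall v, gboundary G Y v -> ~ (1 < degree G v)%N
}.

End Periodic.

Section Decomposition.
Variables (R : realType) (d : nat) (G : graph_data R d).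
Variable Yj : nat -> set 'rV[R]_d.

Definition contact (j : nat) : set 'rV[R]_d :=
  gboundary G (Yj 0) `&` gboundary G (Yj j).

Definition contact_number (j : nat) : nat := #|` fset_set (contact j)|.

Record cell_decomposition (Y : set 'rV[R]_d) (m : nat) : Prop := {
  dec_union : Y = \bigcup_(j in [set j | (j <= m)%N]) Yj j;
  dec_compact : forall j, (j <= m)%N -> compact (Yj j);
  dec_int : forall j, (j <= m)%N -> gint G (Yj j) !=set0;
  dec_connected : forall j, (j <= m)%N -> connected (Yj j);
  dec_disjoint : forall j k, (j <= m)%N -> (k <= m)%N -> j <> k ->
    gint G (Yj j `&` Yj k) = set0;
  dec_ext : ext_boundary G Y `<=` gboundary G (Yj 0);
  dec_contact : forall j, (1 <= j <= m)%N -> contact j !=set0;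
  dec_touch : forall j k, (1 <= j <= m)%N -> (1 <= k <= m)%N -> j <> k ->
    gboundary G (Yj j) `&` gboundary G (Yj k) = set0 \/
    gboundary G (Yj j) `&` gboundary G (Yj k) `<=` gboundary G (Yj 0);
  dec_vertices : forall j, (1 <= j <= m)%N -> contact j `<=` vertices G
}.

End Decomposition.

Section Numbers.
Variables (R : realType) (m : nat).

Definition a_coef (N : nat -> nat) (l q : nat -> R) (j : nat) : R :=
  (N j)%:R * q j / l j.

(* The equation makes sense only away from its poles, whereas division by 0 is
   total here. *)
Definition is_root (a l : nat -> R) (z : R[i]) : Prop :=
  (forall i, (1 <= i <= m)%N -> z <> (a i)%:C%C) /\
  1 + \sum_(1 <= i < m.+1)
        (a i * l i)%:C%C / ((l 0%N)%:C%C * ((a i)%:C%C - z)) = 0.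

Definition ascending_roots (a l : nat -> R) (s : seq R) : Prop :=
  [/\ size s = m, sorted <%R s &
      forall z : R[i], is_root a l z <-> exists2 x, x \in s & z = x%:C%C].

(* The j-th root in ascending order, for 1 <= j <= m. *)
Definition b_coef (a l : nat -> R) (j : nat) : R :=
  nth 0 (xget [::] [set s | ascending_roots a l s]) j.-1.

End Numbers.

Definition ambient_dim (n : nat) : nat := if (n <= 2)%N then 3 else n.

(* Main.v *)
Require Import Defs.
From mathcomp Require Import all_boot all_order all_algebra.
From mathcomp Require Import all_classical all_reals all_analysis.
From mathcomp Require Import complex ring.

(** Up to the choice of the coupling constants, the statement is an identity
    between rational functions.  Positivity of [q j = alpha j * l j / N j]
    forces [l j] and [N j] to be nonzero, whence [a j = alpha j]; and since
    [l j] is proportional to [l 0], also [l 0] is nonzero.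

    With [a = alpha], the prescribed ratios [alpha j * l j / l 0] are the
    coefficients of [1 / (alpha j - z)] in the partial fraction expansion of
      [\prod_i (beta i - z) / (alpha i - z)],
    a function with simple poles at the [alpha j] and limit 1 at infinity
    ([partial_fractions_ratio], an instance of Lagrange interpolation).  The
    left-hand side of the equation defining the [b j] is therefore this very
    product.  Its zeros are the [beta j], none of which is cancelled by a pole
    because the [alpha]s and [beta]s interlace.  Finally, a strictly increasing
    list is determined by its set of entries ([ascending_roots_uniq]), so that
    the [j]-th root is [beta j]. *)

Import Order.TTheory GRing.Theory Num.Theory.
Local Open Scope classical_set_scope.
Local Open Scope ring_scope.

Lemma size_monicB (F : fieldType) (p q : {poly F}) (n : nat) :
  p \is monic -> q \is monic -> size p = n.+1 -> size q = n.+1 ->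
  (size (p - q)%R <= n)%N.
Proof.
move=> /monicP p1 /monicP q1 sp sq; apply/leq_sizeP => j.
rewrite leq_eqVlt => /orP[/eqP <-|ltnj]; rewrite coefB.
  by move: p1 q1; rewrite !lead_coefE sp sq /= => -> ->; rewrite subrr.
by rewrite !nth_default ?subrr // ?sp ?sq.
Qed.

(** The difference of the two monic products has degree less than the number
    of nodes [a i], so it is the Lagrange interpolant of its values there,
    which are those of the first product. *)
Lemma lagrange_prodB (F : fieldType) (I : eqType) (r : seq I) (a b : I -> F)
    (z : F) :
  uniq r -> {in r &, injective a} ->
  \prod_(i <- r) (z - b i) - \prod_(i <- r) (z - a i) =
  \sum_(j <- r) (\prod_(i <- r) (a j - b i) /
                 \prod_(i <- r | i != j) (a j - a i)) *
                \prod_(i <- r | i != j) (z - a i).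
Proof.
move=> ur ainj.
pose P (c : I -> F) (Q : pred I) := \prod_(i <- r | Q i) ('X - (c i)%:P).
have PE c Q x : (P c Q).[x] = \prod_(i <- r | Q i) (x - c i).
  by rewrite horner_prod; apply: eq_bigr => i _; rewrite hornerXsubC.
pose c j := \prod_(i <- r) (a j - b i) / \prod_(i <- r | i != j) (a j - a i).
pose p := P b xpredT - P a xpredT - \sum_(j <- r) c j *: P a (predC1 j).
have pE x : p.[x] = \prod_(i <- r) (x - b i) - \prod_(i <- r) (x - a i)
    - \sum_(j <- r) c j * \prod_(i <- r | i != j) (x - a i).
  rewrite !hornerD !hornerN !PE horner_sum; congr (_ - _).
  by apply: eq_bigr => j _; rewrite hornerZ PE.
suff p0 : p = 0 by apply/eqP; rewrite -subr_eq0 -pE p0 horner0.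
have p_size : (size p <= size r)%N.
  rewrite (leq_trans (size_polyD _ _)) // geq_max size_polyN; apply/andP; split.
    by apply: size_monicB; rewrite ?monic_prod_XsubC ?size_prod_XsubC.
  rewrite big_seq; elim/big_rec: _ => [|j q jr qr]; first by rewrite size_poly0.
  rewrite (leq_trans (size_polyD _ _)) // geq_max qr andbT.
  rewrite (leq_trans (size_scale_leq _ _)) // /P -big_filter size_prod_XsubC.
  by rewrite -rem_filter // size_rem //; case: (r) jr.
have p_roots : all (root p) [seq a i | i <- r].
  apply/allP => _ /mapP[j jr ->]; rewrite rootE pE.
  rewrite (bigD1_seq (F := fun i => a j - a i) j) //= subrr mul0r subr0.
  rewrite [X in _ - X](bigD1_seq j) //= [X in _ - (_ + X)]big1_seq ?addr0; last first.
    move=> k /andP[kj kr]; apply/eqP; rewrite mulf_eq0 prodf_seq_eq0.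
    by apply/orP; right; apply/hasP; exists j => //; rewrite eq_sym kj subrr eqxx.
  rewrite /c divfK ?subrr // prodf_seq_neq0; apply/allP => i ir.
  apply/implyP => ij; rewrite subr_eq0; apply: contra ij => /eqP aij.
  by rewrite (ainj _ _ ir jr (esym aij)).
apply/eqP; apply: contraTT p_size => pn0; rewrite -ltnNge -(size_map a r).
by apply: max_poly_roots; rewrite ?map_inj_in_uniq.
Qed.

Lemma partial_fractions_ratio (F : fieldType) (I : eqType) (r : seq I)
    (a b : I -> F) (z : F) :
  uniq r -> {in r &, injective a} -> {in r, forall i, z != a i} ->
  1 + \sum_(j <- r) (b j - a j) *
        \prod_(i <- r | i != j) ((b i - a j) / (a i - a j)) / (a j - z) =
  \prod_(i <- r) ((b i - z) / (a i - z)).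
Proof.
move=> ur ainj za.
have ratioN (c d e : F) : (c - e) / (d - e) = (e - c) / (e - d).
  by rewrite -[c - e]opprB -[d - e]opprB invrN mulrNN.
have A0 : \prod_(i <- r) (z - a i) != 0.
  by rewrite prodf_seq_neq0; apply/allP => i /za; rewrite subr_eq0.
under [RHS]eq_bigr do rewrite ratioN.
rewrite big_split /= prodfV; apply: (mulIf A0); rewrite divfK // mulrDl mul1r.
have /eqP := lagrange_prodB _ _ _ _ b z ur ainj.
rewrite subr_eq addrC => /eqP ->; congr (_ + _); rewrite mulr_suml.
apply: eq_big_seq => j jr.
rewrite (bigD1_seq (F := fun i => a j - b i) j) //= (bigD1_seq j) //=.
have -> : \prod_(i <- r | i != j) ((b i - a j) / (a i - a j)) =
    \prod_(i <- r | i != j) (a j - b i) / \prod_(i <- r | i != j) (a j - a i).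
  by under eq_bigr do rewrite ratioN; rewrite big_split /= prodfV.
have zaj : z - a j != 0 by rewrite subr_eq0 za.
rewrite -[b j - a j]opprB -[a j - z]opprB invrN.
by move: (\prod_(i <- r | i != j) (a j - a i))^-1 => PaV; field.
Qed.

(** [b_coef] selects some list satisfying [ascending_roots]; this makes the
    selection independent of the choice. *)
Lemma ascending_roots_uniq (R : realType) (m : nat) (a l : nat -> R)
    (s t : seq R) :
  ascending_roots m a l s -> ascending_roots m a l t -> s = t.
Proof.
move=> [_ s_sorted sP] [_ t_sorted tP].
have memE u x : (forall z, is_root m a l z <-> exists2 y, y \in u & z = y%:C%C) ->
    x \in u <-> is_root m a l x%:C%C.
  by move=> uP; rewrite uP; split=> [xu|[y yu /complexI ->//]]; exists x.
by apply: lt_sorted_eq s_sorted t_sorted _ => x; apply/idP/idP; rewrite !memE.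
Qed.

(** Under the interlacing condition no [b i] equals any [a j]: the zeros of the
    product [\prod_i (b i - z) / (a i - z)] are not poles. *)
Lemma ascending_roots_interlacing (R : realType) (m : nat) (a b l : nat -> R) :
  l 0%N != 0 ->
  (forall j, (1 <= j <= m)%N -> a j < b j) ->
  (forall i j, (1 <= i)%N -> (i < j <= m)%N -> b i < a j) ->
  (forall j, (1 <= j <= m)%N ->
     a j * l j = l 0%N * ((b j - a j) *
       \prod_(1 <= i < m.+1 | i != j) ((b i - a j) / (a i - a j)))) ->
  ascending_roots m a l [seq b i | i <- iota 1 m].
Proof.
move=> l0 ab ba alE.
have rE i : (i \in iota 1 m) = (1 <= i <= m)%N by rewrite mem_iota add1n ltnS.
have a_lt i j : (1 <= i)%N -> (i < j <= m)%N -> a i < a j.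
  move=> i1 /andP[ij jm]; apply: lt_trans (ab i _) (ba i j _ _) => //.
    by rewrite i1 (leq_trans (ltnW ij)).
  by rewrite ij.
have b_lt i j : (1 <= i)%N -> (i < j <= m)%N -> b i < b j.
  move=> i1 /andP[ij jm]; apply: lt_trans (ba i j _ _) (ab j _) => //.
    by rewrite ij.
  by rewrite jm andbT (leq_trans i1 (ltnW ij)).
have a_inj : {in iota 1 m &, injective a}.
  move=> i j; rewrite !rE => /andP[i1 im] /andP[j1 jm] aij.
  case: (ltngtP i j) => // ij.
    by have := a_lt i j i1; rewrite ij jm aij ltxx => /(_ isT).
  by have := a_lt j i j1; rewrite ij im aij ltxx => /(_ isT).
have ba_neq i j : (1 <= i <= m)%N -> (1 <= j <= m)%N -> b i <> a j.
  move=> /andP[i1 im] /andP[j1 jm] bij; have [ij|ji] := ltnP i j.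
    by have := ba i j i1; rewrite ij jm bij ltxx => /(_ isT).
  have := ab i; rewrite i1 im bij => /(_ isT); apply/negP; rewrite -leNgt.
  move: ji; rewrite leq_eqVlt => /orP[/eqP ->//|ji].
  by rewrite ltW // a_lt // ji.
have iotaE : index_iota 1 m.+1 = iota 1 m by rewrite /index_iota subn1.
have rootE z : (forall i, (1 <= i <= m)%N -> z <> (a i)%:C%C) ->
  1 + \sum_(1 <= i < m.+1)
        (a i * l i)%:C%C / ((l 0%N)%:C%C * ((a i)%:C%C - z)) =
  \prod_(i <- iota 1 m) (((b i)%:C%C - z) / ((a i)%:C%C - z)).
  move=> za; rewrite iotaE -partial_fractions_ratio ?iota_uniq //; first last.
  - by move=> i; rewrite rE => /za /eqP.
  - by move=> i j ir jr /complexI /a_inj; apply.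
  congr (1 + _); apply: eq_big_seq => j.
  rewrite rE => jm; rewrite alE // iotaE !rmorphM /= rmorphB rmorph_prod /=.
  rewrite invfM mulrACA divff ?mul1r ?fmorph_eq0 //.
  congr (_ * _ * _); apply: eq_bigr => i _.
  by rewrite rmorphM fmorphV !rmorphB.
split.
- by rewrite size_map size_iota.
- apply: (homo_sorted_in (P := mem (iota 1 m)) (e := ltn)) => /=.
  + move=> i j; rewrite !rE => /andP[i1 _] /andP[_ jm] ij.
    by apply: b_lt; rewrite // ij.
  + exact/allP.
  + exact: iota_ltn_sorted.
- move=> z; split=> [[za /eqP]|[_ /mapP[j + ->] ->]].
    rewrite rootE // prodf_seq_eq0 => /hasP[j jr] /=.
    rewrite mulf_eq0 invr_eq0 !subr_eq0 => /orP[/eqP <-|/eqP ajz].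
      by exists (b j) => //; apply: map_f.
    by case: (za j); rewrite -?rE.
  rewrite rE => jm.
  have bP i : (1 <= i <= m)%N -> (b j)%:C%C <> (a i)%:C%C.
    by move=> im /complexI; apply: ba_neq.
  split=> //; rewrite rootE //; apply/eqP; rewrite prodf_seq_eq0.
  by apply/hasP; exists j; rewrite ?rE //= subrr mul0r.
Qed.

Theorem theorem4p1 (R : realType) (n : nat) (hn : (1 <= n)%N)
  (G : graph_data R (ambient_dim n)) (hG : embedded_metric_graph G)
  (per : n.-tuple 'rV[R]_(ambient_dim n)) (hper : periodic_graph G per)
  (Y : set 'rV[R]_(ambient_dim n)) (hY : period_cell G per Y)
  (m : nat) (hm : (1 <= m)%N)
  (Yj : nat -> set 'rV[R]_(ambient_dim n)) (hYj : cell_decomposition G Yj Y m)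
  (L : R) (hL : 0 < L) (alpha beta : nat -> R)
  (halpha1 : 0 < alpha 1%N)
  (halphabeta : forall j, (1 <= j <= m.-1)%N ->
     alpha j < beta j /\ beta j < alpha j.+1)
  (hbetaL : alpha m < beta m /\ beta m < L)
  (q : nat -> R) (hq : forall j, (1 <= j <= m)%N -> 0 < q j) :
  let l := fun j : nat => total_length G (Yj j) in
  let N := contact_number G Yj in
  let a := a_coef N l q in
  let b := b_coef m a l in
  (forall j, (1 <= j <= m)%N ->
     l j = l 0%N * ((beta j - alpha j) / alpha j) *
       \prod_(1 <= i < m.+1 | i != j)
         ((beta i - alpha j) / (alpha i - alpha j))) ->
  (forall j, (1 <= j <= m)%N -> q j = alpha j * l j / (N j)%:R) ->
  forall j, (1 <= j <= m)%N -> a j = alpha j /\ b j = beta j.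
Proof.
move=> l N a b lE qE.
(* Division by 0 gives 0, so the positivity of q rules out l j = 0 and
   N j = 0. *)
have lN_neq0 j : (1 <= j <= m)%N -> l j != 0 /\ (N j)%:R != 0 :> R.
  move=> jm; have := lt0r_neq0 (hq j jm); rewrite qE // !mulf_eq0 invr_eq0.
  by rewrite !negb_or => /andP[/andP[_ ->] ->].
have aE j : (1 <= j <= m)%N -> a j = alpha j.
  move=> jm; have [lj Nj] := lN_neq0 j jm.
  by rewrite /a /a_coef qE //; field; rewrite lj.
have l0 : l 0%N != 0.
  have := lN_neq0 1%N; rewrite hm => /(_ isT)[+ _].
  by rewrite lE ?hm // !mulf_eq0 !negb_or => /andP[/andP[]].
have alpha_beta j : (1 <= j <= m)%N -> alpha j < beta j.
  case/andP => j1; rewrite leq_eqVlt => /orP[/eqP ->|jm]; first by case: hbetaL.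
  by have [] := halphabeta j; rewrite // j1 -ltnS prednK.
have beta_alpha i j : (1 <= i)%N -> (i < j <= m)%N -> beta i < alpha j.
  move=> i1; elim: j => // j IH /andP[]; rewrite ltnS leq_eqVlt => ij jm.
  have j1 : (1 <= j)%N by case/orP: ij => [/eqP <-//|/ltnW/(leq_trans i1)].
  have [abj baj] : alpha j < beta j /\ beta j < alpha j.+1.
    by apply: halphabeta; rewrite j1 -ltnS prednK.
  case/orP: ij => [/eqP ->//|ij].
  by apply: lt_trans baj; apply: lt_trans abj; rewrite IH // ij ltnW.
have alpha_gt0 j : (1 <= j <= m)%N -> 0 < alpha j.
  case/andP => j1 jm; case: (ltngtP 1 j) j1 => // [j1 _|<- //].
  apply: lt_trans halpha1 _; apply: lt_trans (alpha_beta _ _) _; first exact: hm.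
  by apply: beta_alpha; rewrite ?j1.
have roots : ascending_roots m a l [seq beta i | i <- iota 1 m].
  apply: ascending_roots_interlacing => // [j jm|i j i1 jm|j jm].
  - by rewrite aE // alpha_beta.
  - rewrite aE ?beta_alpha //; case/andP: jm => ij ->.
    by rewrite (leq_trans i1) // ltnW.
  - rewrite [in LHS]lE // aE // mulrCA -!mulrA; congr (_ * _).
    have -> : \prod_(1 <= i < m.+1 | i != j) ((beta i - alpha j) / (a i - alpha j))
            = \prod_(1 <= i < m.+1 | i != j)
                ((beta i - alpha j) / (alpha i - alpha j)).
      rewrite big_nat_cond [RHS]big_nat_cond; apply: eq_bigr => i /andP[im _].
      by rewrite aE.
    by field; rewrite gt_eqF // alpha_gt0.
move=> j jm; split; first exact: aE.
rewrite /b /b_coef; have := xgetPex [::] (ex_intro _ _ roots).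
move=> /ascending_roots_uniq /(_ roots) ->.
case/andP: jm => j1 jm.
by rewrite (nth_map 0%N) ?size_iota ?nth_iota ?add1n prednK.
Qed.
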